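(* Let $d=(d_k)_{k\in\mathbb{N}}\in\ell^\infty$. Then $$\|M_d\|_w=\|F_d\|_w=\|B_d\|_w=\|d\|_\infty .$$
   Context: $\mathbb{N}=\{1,2,3,\dots\}$. $\ell^2$ is the complex Hilbert space of square-summable unilateral sequences, and $\ell^\infty$ the complex Banach space of bounded complex sequences with the uniform norm $\|\cdot\|_\infty$. For $a\in\ell^\infty$, the (unilateral) weighted forward shift $T_a:\ell^2\to\ell^2$ is the bounded operator $T_a(x_1,x_2,\dots)=(0,a_1x_1,a_2x_2,\dots)$. The numerical radius of a bounded operator $T$ on a complex Hilbert space $H$ is $w(T)=\sup\{|\langle Tx,x\rangle| : x\in H,\ \|x\|=1\}$. Set $\|a\|_w:=w(T_a)$, which is a norm on $\ell^\infty$. For a bounded linear map $R:\ell^\infty\to\ell^\infty$, its operator norm with respect to $\|\cdot\|_w$ is $\|R\|_w:=\sup\{\|Ra\|_w : a\in\ell^\infty,\ \|a\|_w=1\}$. For $d\in\ell^\infty$ the following operators on $\ell^\infty$ are considered: the multiplication operator $M_d a=(d_ka_k)_{k\in\mathbb{N}}$; the weighted forward shift $F_d a=(0,d_1a_1,d_2a_2,\dots)$; the weighted backward shift $B_d a=(d_ka_{k+1})_{k\in\mathbb{N}}=(d_1a_2,d_2a_3,\dots)$. *)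

(* Defs.v *)
From HB Require Import structures.
From mathcomp Require Import all_boot all_order all_algebra.
From mathcomp Require Import all_classical all_reals all_analysis.
From mathcomp Require Import complex ring.

Set Implicit Arguments.
Unset Strict Implicit.
Unset Printing Implicit Defensive.

Import Order.TTheory GRing.Theory Num.Theory.
Import numFieldNormedType.Exports.
Import ComplexField.Normc.

Local Open Scope classical_set_scope.
Local Open Scope ring_scope.
Local Open Scope complex_scope.

(* The usual topology of the complex numbers; [R[i]^o] already carries it, but
   [R[i]] itself does not. *)
HB.instance Definition _ (R : realType) := NormedModule.copy R[i] R[i]^o.

(* Sequences are indexed by nat: the k-th entry here is the (k+1)-st entry of a
   sequence indexed by {1, 2, 3, ...}. *)

Section sequence_spaces.
Context {R : realType}.
Implicit Types x y : nat -> R[i].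

Definition linf_pred : {pred nat -> R[i]} :=
  mem [set x | has_ubound (range (fun k => normc (x k)))].

Definition ell2_pred : {pred nat -> R[i]} :=
  mem [set x | cvgn (series (fun k => normc (x k) ^+ 2))].

Lemma normc_ge0 (z : R[i]) : 0 <= normc z.
Proof. by case: z => ? ?; rewrite sqrtr_ge0. Qed.

Lemma linfP x :
  reflect (exists M : R, forall k, normc (x k) <= M) (x \in linf_pred).
Proof.
apply: (iffP idP) => [|[M xM]]; rewrite inE /=.
  by move=> [M xM]; exists M => k; apply: xM; exists k.
by exists M => _ [k _ <-].
Qed.

Lemma ell2P x :
  reflect (cvgn (series (fun k => normc (x k) ^+ 2))) (x \in ell2_pred).
Proof. by apply: (iffP idP); rewrite inE. Qed.

Lemma linf_submod_closed : submod_closed linf_pred.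
Proof.
split=> [|c x y /linfP[M xM] /linfP[N yN]]; apply/linfP.
  by exists 0 => k; rewrite normc0.
exists (normc c * M + N) => k; apply: (le_trans (le_normcD _ _)).
by rewrite normcM lerD// ler_wpM2l// normc_ge0.
Qed.

HB.instance Definition _ :=
  GRing.isSubmodClosed.Build R[i] (nat -> R[i]) linf_pred linf_submod_closed.

Lemma ell2_dom x y (c : R) : y \in ell2_pred ->
  (forall k, normc (x k) <= c * normc (y k)) -> x \in ell2_pred.
Proof.
move=> /ell2P y2 xy; apply/ell2P.
apply: (@series_le_cvg _ _ (fun k => c ^+ 2 * normc (y k) ^+ 2)) => [k|k|k|].
- exact: sqr_ge0.
- by rewrite mulr_ge0// sqr_ge0.
- rewrite -exprMn lerXn2r// nnegrE ?normc_ge0//.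
  by rewrite (le_trans _ (xy k))// normc_ge0.
- have -> : (fun k => c ^+ 2 * normc (y k) ^+ 2) =
            c ^+ 2 *: (fun k => normc (y k) ^+ 2) by [].
  exact: is_cvg_seriesZ.
Qed.

Lemma ell2_submod_closed : submod_closed ell2_pred.
Proof.
split=> [|c x y /ell2P x2 /ell2P y2]; apply/ell2P.
  rewrite (_ : series _ = fun=> 0); first exact: is_cvg_cst.
  apply/funext => n; rewrite /series /= big1// => k _.
  by rewrite !expr0n/= addr0 sqrtr0 expr0n.
pose u := (2 * normc c ^+ 2) *: (fun k => normc (x k) ^+ 2) +
          2 *: (fun k => normc (y k) ^+ 2).
have uE k : u k = 2 * normc c ^+ 2 * normc (x k) ^+ 2 + 2 * normc (y k) ^+ 2.
  by [].
apply: (@series_le_cvg _ _ u) => [k|k|k|].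
- exact: sqr_ge0.
- rewrite uE; do ?[apply: addr_ge0|apply: mulr_ge0];
    by rewrite ?ler0n ?normc_ge0.
- have h (a b : R) : (a + b) ^+ 2 <= 2 * a ^+ 2 + 2 * b ^+ 2.
    rewrite -subr_ge0 (_ : _ - _ = (a - b) ^+ 2) ?sqr_ge0//.
    by ring.
  apply: le_trans (_ : (normc c * normc (x k) + normc (y k)) ^+ 2 <= _).
    rewrite lerXn2r// ?nnegrE ?addr_ge0 ?mulr_ge0 ?normc_ge0//.
    by rewrite (le_trans (le_normcD _ _))// normcM.
  by rewrite uE (le_trans (h _ _))// exprMn mulrA.
- by apply: is_cvg_seriesD; exact: is_cvg_seriesZ.
Qed.

HB.instance Definition _ :=
  GRing.isSubmodClosed.Build R[i] (nat -> R[i]) ell2_pred ell2_submod_closed.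

End sequence_spaces.

Section operators.
Context (R : realType).

Record linf := Linf {
  linf_seq :> nat -> R[i];
  linf_in : linf_seq \in linf_pred
}.
Record ell2 := Ell2 {
  ell2_seq :> nat -> R[i];
  ell2_in : ell2_seq \in ell2_pred
}.

HB.instance Definition _ := [isSub for linf_seq].
HB.instance Definition _ := [Choice of linf by <:].
HB.instance Definition _ := [SubChoice_isSubLmodule of linf by <:].

HB.instance Definition _ := [isSub for ell2_seq].
HB.instance Definition _ := [Choice of ell2 by <:].
HB.instance Definition _ := [SubChoice_isSubLmodule of ell2 by <:].

Implicit Types (d a : linf) (x y : ell2).

Definition linf_norm d : \bar R :=
  ereal_sup (range (fun k => (normc (d k))%:E)).

Definition ell2_norm x : R :=
  Num.sqrt (limn (series (fun k => normc (x k) ^+ 2))).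

Definition ell2_dot x y : R[i] := limn (series (fun k => x k * (y k)^*)).

Definition mul_seq (d a : nat -> R[i]) : nat -> R[i] := fun k => d k * a k.

Definition fshift_seq (d a : nat -> R[i]) : nat -> R[i] :=
  fun k => if k is j.+1 then d j * a j else 0.

Definition bshift_seq (d a : nat -> R[i]) : nat -> R[i] :=
  fun k => d k * a k.+1.

Lemma mul_seq_linf d a : mul_seq d a \in linf_pred.
Proof.
have [/linfP[M dM] /linfP[N aN]] := (linf_in d, linf_in a).
by apply/linfP; exists (M * N) => k; rewrite normcM ler_pM// normc_ge0.
Qed.

Lemma fshift_seq_linf d a : fshift_seq d a \in linf_pred.
Proof.
have /linfP[M daM] := mul_seq_linf d a.
apply/linfP; exists M => -[|k]; last exact: daM.
by rewrite [fshift_seq _ _ _]/0 normc0 (le_trans _ (daM 0%N))// normc_ge0.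
Qed.

Lemma bshift_seq_linf d a : bshift_seq d a \in linf_pred.
Proof.
have [/linfP[M dM] /linfP[N aN]] := (linf_in d, linf_in a).
by apply/linfP; exists (M * N) => k; rewrite normcM ler_pM// normc_ge0.
Qed.

Lemma fshift_seq_ell2 a x : fshift_seq a x \in ell2_pred.
Proof.
have /linfP[M aM] := linf_in a.
have /ell2P : mul_seq a x \in ell2_pred.
  apply: (ell2_dom (ell2_in x)) => k.
  by rewrite normcM ler_wpM2r// normc_ge0.
move=> /cvg_ex[l axl]; apply/ell2P/cvg_ex; exists l; rewrite -cvg_shiftS.
rewrite (_ : [sequence _]_n = series (fun k => normc (mul_seq a x k) ^+ 2))//.
by apply/funext => n; rewrite /series [LHS]big_nat_recl// normc0 expr0n add0r.
Qed.

Definition mulop d : linf -> linf := fun a => Linf (mul_seq_linf d a).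
Definition fshift d : linf -> linf := fun a => Linf (fshift_seq_linf d a).
Definition bshift d : linf -> linf := fun a => Linf (bshift_seq_linf d a).
Definition wshift a : ell2 -> ell2 := fun x => Ell2 (fshift_seq_ell2 a x).

Lemma mul_lin (z c u v : R[i]) : z * (c * u + v) = c * (z * u) + z * v.
Proof. by rewrite mulrDr mulrCA. Qed.

Fact mulop_linear d : linear (mulop d).
Proof.
by move=> c a b; apply/val_inj/funext => k; exact: mul_lin.
Qed.
HB.instance Definition _ d :=
  GRing.isLinear.Build R[i] linf linf _ (mulop d) (mulop_linear d).

Fact fshift_linear d : linear (fshift d).
Proof.
move=> c a b; apply/val_inj/funext => -[|k]; last exact: mul_lin.
have : c * 0 + 0 = 0 :> R[i] by rewrite mulr0 addr0.
by move/esym.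
Qed.
HB.instance Definition _ d :=
  GRing.isLinear.Build R[i] linf linf _ (fshift d) (fshift_linear d).

Fact bshift_linear d : linear (bshift d).
Proof.
by move=> c a b; apply/val_inj/funext => k; exact: mul_lin.
Qed.
HB.instance Definition _ d :=
  GRing.isLinear.Build R[i] linf linf _ (bshift d) (bshift_linear d).

Fact wshift_linear a : linear (wshift a).
Proof.
move=> c x y; apply/val_inj/funext => -[|k]; last exact: mul_lin.
have : c * 0 + 0 = 0 :> R[i] by rewrite mulr0 addr0.
by move/esym.
Qed.
HB.instance Definition _ a :=
  GRing.isLinear.Build R[i] ell2 ell2 _ (wshift a) (wshift_linear a).

(* Suprema are taken in the extended reals, so that no convention about
   unbounded sets is involved. *)
Definition numerical_radius (T : {linear ell2 -> ell2}) : \bar R :=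
  ereal_sup [set (normc (ell2_dot (T x) x))%:E | x in [set x | ell2_norm x = 1]].

Definition wnorm a : \bar R := numerical_radius (wshift a).

Definition wopnorm (S : {linear linf -> linf}) : \bar R :=
  ereal_sup [set wnorm (S a) | a in [set a | wnorm a = 1%E]].

End operators.

(* Main.v *)
Require Import Defs.
From mathcomp Require Import all_boot all_order all_algebra.
From mathcomp Require Import all_classical all_reals all_analysis.
From mathcomp Require Import complex.
From mathcomp Require Import ring lra.

Set Implicit Arguments.
Unset Strict Implicit.
Unset Printing Implicit Defensive.

Import Order.TTheory GRing.Theory Num.Theory.
Import numFieldNormedType.Exports.
Import ComplexField.Normc.

Local Open Scope classical_set_scope.
Local Open Scope ring_scope.
Local Open Scope complex_scope.

(** The numerical radius of [T_a] only depends on the moduli [|a_k|], and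
    monotonically so: it is the supremum of the finite sums
      [\sum_(k < n) |a_k| r_k r_(k+1)]
    over the nonnegative real [r] with [\sum_(k <= n) r_k ^ 2 <= 1].  Such a sum
    bounds [<T_a x, x>] through the triangle inequality with [r_k = |x_k|], and
    conversely some unit vector [x], with phases that cancel those of [a], makes
    [<T_a x, x>] at least that large.  This is [wnorm_leP].

    Upper bounds.  If [|b_k| <= D |a_k|] for all [k] and [|a|_w <= 1] then
    [|b|_w <= D] ([wnorm_dominated]), which settles [M_d] with [D = |d|_oo].  Since
    [F_d a = (0, M_d a)] and [B_d a] is [M_d] applied to the tail of [a], the two
    shifts follow once prepending a zero to a sequence, or dropping its head,
    is known not to increase [|.|_w] ([wnorm_shift_right],
    [wnorm_shift_left]).

    Lower bounds.  A sequence with a single nonzero entry [c] has [|.|_w]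
    equal to [|c| / 2], by [2 r_j r_(j+1) <= r_j ^ 2 + r_(j+1) ^ 2]
    ([wnorm_single]).  Each of the three operators sends some spike of height 2,
    a [w]-unit vector, to a spike of height [2 d_j], whose [w]-norm is [|d_j|];
    the supremum over [j] is [|d|_oo] ([wopnorm_eq]). *)

Arguments normc : simpl never.

(** * Limits and moduli of complex sequences *)

Section limits.

Section finite_support.
Context {K : numFieldType} {V : normedModType K} (u : nat -> V) (N : nat)
  (u0 : forall k, (N <= k)%N -> u k = 0).

Lemma cvg_series_finite_support_to : series u @ \oo --> \sum_(k < N) u k.
Proof.
apply: cvg_near_cst; exists N => // n /= Nn.
rewrite seriesEnat /= (big_cat_nat (leq0n N) Nn)/= [X in _ + X]big_nat.
rewrite [X in _ + X]big1 ?addr0 ?big_mkord// => k /andP[/u0].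
by [].
Qed.

Lemma cvg_series_finite_support : cvgn (series u).
Proof. by apply/cvg_ex; eexists; exact: cvg_series_finite_support_to. Qed.

Lemma lim_series_finite_support : limn (series u) = \sum_(k < N) u k.
Proof. apply: cvg_lim; [exact: norm_hausdorff|exact: cvg_series_finite_support_to]. Qed.

End finite_support.

Lemma norm_normc (R : realType) (z : R[i]) : `|z| = (normc z)%:C.
Proof. by case: z => a b; rewrite normc_def. Qed.

Lemma normc_real (R : realType) (r : R) : normc r%:C = `|r|.
Proof. by rewrite /normc /= expr0n /= addr0 sqrtr_sqr. Qed.

Lemma normc_conj (R : realType) (z : R[i]) : normc (z^*)%R = normc z.
Proof. by case: z => a b; rewrite /normc /= sqrrN. Qed.

Lemma mul_conj (R : realType) (z : R[i]) : z * z^* = (normc z ^+ 2)%:C.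
Proof. by rewrite -sqr_normc norm_normc -rmorphXn. Qed.

Lemma conj_real (R : realType) (r : R) : (r%:C^*)%R = r%:C.
Proof. exact: conjc_real. Qed.

Lemma normc_sum (R : realType) (I : Type) (r : seq I) (F : I -> R[i]) :
  normc (\sum_(i <- r) F i) <= \sum_(i <- r) normc (F i).
Proof.
elim/big_ind2 : _ => [|x a y b xa yb|//]; first by rewrite normc0.
by rewrite (le_trans (le_normcD _ _))// lerD.
Qed.

(** No convergence is assumed: the limit of a divergent sequence is by
    convention 0, which satisfies the bound as well. *)
Lemma normc_limn_le (R : realType) (u : nat -> R[i]) (M : R) :
  (forall n, normc (u n) <= M) -> normc (limn u) <= M.
Proof.
move=> uM; have [ucvg|udvg] := pselect (cvgn u); last first.
  by rewrite (dvgP udvg) normc0 (le_trans (normc_ge0 _) (uM 0%N)).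
rewrite leNgt; apply/negP => Ml.
move/cvgrPdist_lt : ucvg => /(_ (normc (limn u) - M)%:C).
rewrite ltcR subr_gt0 => /(_ Ml)[n _ /(_ n (leqnn n))].
rewrite norm_normc ltcR => h.
have : normc (limn u) <= normc (limn u - u n) + normc (u n).
  by rewrite -[X in normc X <= _](subrK (u n)) le_normcD.
by have := uM n; lra.
Qed.

End limits.

(** * The numerical radius as a supremum of finite real sums *)

Section shift_form.
Context {R : realType}.
Implicit Types (a b : nat -> R[i]) (r : nat -> R).

Definition shift_form a n r : R := \sum_(k < n) normc (a k) * (r k * r k.+1).

(** These unimodular phases make every term [a_k x_k (x_(k+1))^*] of the
    quadratic form of [T_a] nonnegative when the moduli of [x] are prescribed;
    [u] is the running product of the signs [a_k / |a_k|]. *)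
Lemma phases a : exists u : nat -> R[i], (forall k, normc (u k) = 1) /\
  (forall k, a k * u k * (u k.+1)^* = (normc (a k))%:C).
Proof.
pose w k := if a k == 0 then 1 else a k / (normc (a k))%:C.
pose u := fix u k := if k is j.+1 then u j * w j else 1.
have nz k : a k != 0 -> normc (a k) != 0.
  by apply: contra_neq; exact: eq0_normc.
have w1 k : normc (w k) = 1.
  rewrite /w; case: eqP => [_|/eqP/nz ak0]; first exact: normc1.
  by rewrite normcM normcV normc_real ger0_norm ?normc_ge0 ?divff.
have u1 k : normc (u k) = 1.
  by elim: k => [|k IH] /=; rewrite ?normc1// normcM IH w1 mulr1.
exists u; split=> // k.
rewrite [u k.+1]/= rmorphM/= mulrA -(mulrA (a k)) mul_conj u1 expr1n mulr1.
rewrite /w; case: eqP => [->|/eqP/nz ak0]; first by rewrite mul0r normc0.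
rewrite rmorphM fmorphV/= conj_real mulrA mul_conj -fmorphV -rmorphM/=; congr (_ %:C).
by rewrite expr2 mulfK.
Qed.

(** The profile [r] is cut after the index [n], given the phases that cancel
    those of [a], and completed to norm exactly 1. *)
Lemma shift_form_le_wnorm (a : linf R) n r : (forall k, 0 <= r k) ->
  \sum_(k < n.+1) r k ^+ 2 <= 1 -> ((shift_form a n r)%:E <= wnorm a)%E.
Proof.
move=> r0 r1; have [u [u1 au]] := phases a.
pose s : R := Num.sqrt (1 - \sum_(k < n.+1) r k ^+ 2).
(* The missing mass is put at [n.+2] rather than [n.+1], so that it is not
   adjacent to the support of the profile. *)
pose t k := if (k <= n)%N then r k else if k == n.+2 then s else 0.
have t0 k : (n.+3 <= k)%N -> t k = 0.
  by move=> nk; rewrite /t leqNgt (leq_trans _ nk) ?ltnS 1?ltnW//= gtn_eqF.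
have tge0 k : 0 <= t k.
  by rewrite /t; case: ifP => // _; case: ifP => // _; exact: sqrtr_ge0.
pose y k := (t k)%:C * u k.
have ny k : normc (y k) = t k.
  by rewrite normcM u1 mulr1 normc_real ger0_norm.
have nyE : (fun k => normc (y k) ^+ 2) = (fun k => t k ^+ 2).
  by apply/funext => k; rewrite ny.
have t20 k : (n.+3 <= k)%N -> t k ^+ 2 = 0 by move=> /t0 ->; rewrite expr0n.
have y2 : y \in ell2_pred.
  apply/ell2P; rewrite nyE.
  exact: (@cvg_series_finite_support R R^o _ n.+3).
pose Y := Ell2 y2.
have Y1 : ell2_norm Y = 1.
  rewrite /ell2_norm /= nyE (@lim_series_finite_support R R^o _ n.+3)//.
  rewrite 2!big_ord_recr/= (eq_bigr (fun k : 'I_n.+1 => r k ^+ 2)); last first.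
    by move=> k _; rewrite /t -ltnS ltn_ord.
  rewrite /t ltnn eqxx ltnNge leqnSn /= ltn_eqF// expr0n/= addr0.
  by rewrite sqr_sqrtr ?subr_ge0// subrKC sqrtr1.
apply: (@le_trans _ _ (normc (ell2_dot (wshift a Y) Y))%:E); last first.
  by apply: ereal_sup_ubound; exists Y.
rewrite lee_fin /ell2_dot (@lim_series_finite_support _ _ _ n.+3); last first.
  by move=> k nk; rewrite /= {2}/y t0// mul0r rmorph0 mulr0.
rewrite big_ord_recl/= mul0r add0r.
rewrite (eq_bigr (fun k : 'I_n.+2 => (normc (a k) * (t k * t k.+1))%:C)); last first.
  move=> k _; rewrite /bump/= add1n /y !rmorphM/= conj_real -(au k).
  by ring.
rewrite -rmorph_sum normc_real ger0_norm; last first.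
  by apply: sumr_ge0 => k _; rewrite !mulr_ge0 ?normc_ge0.
rewrite !big_ord_recr/= /shift_form.
rewrite -addrA [leLHS](eq_bigr (fun k : 'I_n => normc (a k) * (t k * t k.+1))).
  by rewrite lerDl addr_ge0// !mulr_ge0 ?normc_ge0.
by move=> k _; rewrite /t ltn_ord ltnW.
Qed.

(** This reduces every estimate on [|.|_w] below to finite sums of nonnegative
    reals. *)
Lemma wnorm_leP (a : linf R) (M : R) : (wnorm a <= M%:E)%E <->
  (forall n r, (forall k, 0 <= r k) -> \sum_(k < n.+1) r k ^+ 2 <= 1 ->
    shift_form a n r <= M).
Proof.
split=> [aM n r r0 r1|aM].
  by rewrite -lee_fin (le_trans (shift_form_le_wnorm a r0 r1)).
apply: ge_ereal_sup => _ [x /= x1 <-]; rewrite lee_fin.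
pose r k := normc (x k).
have r1 n : \sum_(k < n) r k ^+ 2 <= 1.
  have /ell2P xcvg := ell2_in x.
  have lim1 : limn (series (fun k => normc (x k) ^+ 2)) = 1.
    have [l0|/ltW/ler0_sqrtr l0] := leP 0 (limn (series (fun k => normc (x k) ^+ 2))).
      by rewrite -(sqr_sqrtr l0) [X in X ^+ 2]x1 expr1n.
    by move: x1; rewrite /ell2_norm l0 => /esym/eqP; rewrite oner_eq0.
  rewrite -lim1 -(big_mkord xpredT (fun k => r k ^+ 2)).
  apply: (nondecreasing_cvgn_le _ xcvg n).
  by apply: nondecreasing_series => k _ _; exact: sqr_ge0.
have r0 k : 0 <= r k by exact: normc_ge0.
apply: normc_limn_le => -[|n]; rewrite seriesEord/=.
  rewrite big_ord0 normc0; have := aM 0%N r r0 (r1 _).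
  by rewrite /shift_form big_ord0.
apply: le_trans (aM n r r0 (r1 _)).
rewrite big_ord_recl/= mul0r add0r (le_trans (normc_sum _ _))//.
apply: ler_sum => k _; rewrite /bump/= add1n !normcM normc_conj.
by rewrite -mulrA.
Qed.

Lemma wnorm_dominated (a b : linf R) (D : R) :
  (forall k, normc (b k) <= D * normc (a k)) -> 0 <= D ->
  (wnorm a <= 1)%E -> (wnorm b <= D%:E)%E.
Proof.
move=> ba D0 /wnorm_leP a1; apply/wnorm_leP => n r r0 r1.
apply: (@le_trans _ _ (D * shift_form a n r)); last by rewrite ler_piMr// a1.
rewrite /shift_form mulr_sumr; apply: ler_sum => k _.
by rewrite [leRHS]mulrA ler_wpM2r// mulr_ge0.
Qed.

(** Prepending a zero to [a] shifts the profile the other way, which only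
    loses the mass [r_0 ^ 2]. *)
Lemma wnorm_shift_right (a b : linf R) (M : R) :
  b 0%N = 0 -> (forall k, b k.+1 = a k) ->
  (wnorm a <= M%:E)%E -> (wnorm b <= M%:E)%E.
Proof.
move=> b0 ba /wnorm_leP aM; apply/wnorm_leP => -[|n] r r0 r1.
  by have := aM 0%N r r0 r1; rewrite /shift_form !big_ord0.
rewrite /shift_form big_ord_recl/= b0 normc0 mul0r add0r.
under eq_bigr => k _ do rewrite /bump/= add1n ba.
apply: (aM n (fun k => r k.+1)) => //.
by apply: le_trans r1; rewrite [leRHS]big_ord_recl lerDr sqr_ge0.
Qed.

(** Dropping the head of [a] amounts to testing [a] on profiles that start
    with 0. *)
Lemma wnorm_shift_left (a b : linf R) (M : R) : (forall k, b k = a k.+1) ->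
  (wnorm a <= M%:E)%E -> (wnorm b <= M%:E)%E.
Proof.
move=> ba /wnorm_leP aM; apply/wnorm_leP => n r r0 r1.
pose r' k := if k is j.+1 then r j else 0.
apply: le_trans (aM n.+1 r' _ _) => [|[|k]//=|].
- rewrite [leRHS]/shift_form big_ord_recl/= mul0r mulr0 add0r.
  by apply: ler_sum => k _; rewrite ba.
- by rewrite big_ord_recl/= expr0n/= add0r.
Qed.

(** The form is [|c| r_j r_(j+1)], and [r_j r_(j+1) <= 1 / 2] with equality
    when both coordinates are [sqrt (1 / 2)]. *)
Lemma wnorm_single (a : linf R) j : (forall k, k != j -> a k = 0) ->
  wnorm a = (normc (a j) / 2)%:E.
Proof.
move=> a0.
have formE n r : (j < n)%N ->
    shift_form a n r = normc (a j) * (r j * r j.+1).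
  move=> jn; rewrite /shift_form (bigD1 (Ordinal jn))//= big1 ?addr0// => k kj.
  by rewrite a0 ?normc0 ?mul0r.
apply/eqP; rewrite eq_le; apply/andP; split.
  apply/wnorm_leP => n r r0 r1; have [jn|nj] := ltnP j n; last first.
    rewrite /shift_form big1 ?divr_ge0 ?normc_ge0// => k _.
    by rewrite a0 ?normc0 ?mul0r// ltn_eqF// (leq_trans _ nj).
  rewrite formE// ler_wpM2l ?normc_ge0//.
  have : r j ^+ 2 + r j.+1 ^+ 2 <= 1.
    apply: le_trans r1; rewrite (bigD1 (Ordinal (ltnW jn : j < n.+1)%N))//=.
    rewrite (bigD1 (Ordinal (jn : j.+1 < n.+1)%N)) -?val_eqE/= ?gtn_eqF//.
    by rewrite addrA lerDl sumr_ge0// => k _; exact: sqr_ge0.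
  by have := sqr_ge0 (r j - r j.+1); rewrite sqrrB; lra.
pose h : R := Num.sqrt 2^-1.
have h2 : h ^+ 2 = 2^-1 by rewrite sqr_sqrtr.
pose r k := if (k == j) || (k == j.+1) then h else 0.
apply: le_trans (_ : (shift_form a j.+1 r)%:E <= _)%E; last first.
  apply: shift_form_le_wnorm => [k|].
    by rewrite /r; case: ifP => // _; exact: sqrtr_ge0.
  rewrite 2!big_ord_recr/= big1 => [|k _].
    by rewrite /r !eqxx orbT h2; lra.
  by rewrite /r !ltn_eqF ?expr0n// (leq_trans (ltn_ord k)).
by rewrite formE// lee_fin /r !eqxx orbT/= -expr2 h2.
Qed.

End shift_form.

(** * Operator norms, tested on sequences with one nonzero entry *)

Section spikes.
Context {R : realType}.

Lemma spike_linf j (c : R[i]) :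
  (fun k => if k == j then c else 0) \in @linf_pred R.
Proof.
apply/linfP; exists (normc c) => k; case: ifP => // _.
by rewrite normc0 normc_ge0.
Qed.

Definition spike j c : linf R := Linf (spike_linf j c).

Lemma wnorm_spike j c : wnorm (spike j c) = (normc c / 2)%:E.
Proof.
rewrite (@wnorm_single _ _ j) /= ?eqxx// => k /negbTE kj.
by rewrite /= kj.
Qed.

(** The three operators share this argument: spikes of height 2 are unit
    vectors for [|.|_w], and [S] maps the one at [src j] to a vector of norm
    [|d_j|], so no bound smaller than [|d|_oo] is possible. *)
Lemma wopnorm_eq (d : linf R) (S : {linear linf R -> linf R})
    (src tgt : nat -> nat) :
  (forall D a, (forall k, normc (d k) <= D) -> (wnorm a <= 1)%E ->
    (wnorm (S a) <= D%:E)%E) ->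
  (forall j c, S (spike (src j) c) = spike (tgt j) (d j * c)) ->
  wopnorm S = linf_norm d.
Proof.
move=> Sle Sspike; apply/eqP; rewrite eq_le; apply/andP; split.
  apply: ge_ereal_sup => _ [a /= a1 <-].
  have dle k : ((normc (d k))%:E <= linf_norm d)%E.
    by apply: ereal_sup_ubound; exists k.
  case: (linf_norm d) dle => [D dD| |/(_ 0%N)//]; last by rewrite leey.
  by apply: Sle; rewrite ?a1.
apply: ge_ereal_sup => _ [j _ <-]; apply: ereal_sup_ubound.
have n2 : normc (2 : R[i]) = 2.
  by rewrite -[2 : R[i]](rmorph_nat (real_complex R)) normc_real normr_nat.
exists (spike (src j) 2); rewrite /= ?Sspike wnorm_spike ?normcM n2 ?mulfK//.
by rewrite divff.
Qed.

Lemma wnorm_mulop_le (d a : linf R) (D : R) :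
  (forall k, normc (d k) <= D) -> (wnorm a <= 1)%E ->
  (wnorm (mulop d a) <= D%:E)%E.
Proof.
move=> dD; apply: wnorm_dominated => [k|].
  by rewrite normcM ler_wpM2r ?normc_ge0.
exact: le_trans (normc_ge0 _) (dD 0%N).
Qed.

Lemma wopnorm_mulop (d : linf R) : wopnorm (mulop d) = linf_norm d.
Proof.
apply: (@wopnorm_eq d _ id id) => [D a|j c]; first exact: wnorm_mulop_le.
apply/val_inj/funext => k /=; rewrite /mul_seq.
by case: eqP => [->|_]; rewrite ?mulr0.
Qed.

Lemma wopnorm_fshift (d : linf R) : wopnorm (fshift d) = linf_norm d.
Proof.
apply: (@wopnorm_eq d _ id S) => [D a dD a1|j c].
  exact: (@wnorm_shift_right _ (mulop d a)) (wnorm_mulop_le dD a1).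
apply/val_inj/funext => -[|k] //=; rewrite eqSS.
by case: eqP => [->|_]; rewrite ?mulr0.
Qed.

Lemma tail_linf (a : linf R) : (fun k => a k.+1) \in @linf_pred R.
Proof. by have /linfP[M aM] := linf_in a; apply/linfP; exists M. Qed.

Lemma wopnorm_bshift (d : linf R) : wopnorm (bshift d) = linf_norm d.
Proof.
apply: (@wopnorm_eq d _ S id) => [D a dD a1|j c].
  apply: (@wnorm_mulop_le d (Linf (tail_linf a))) => //.
  exact: (@wnorm_shift_left _ a _ 1).
apply/val_inj/funext => k /=; rewrite /bshift_seq /= eqSS.
by case: eqP => [->|_]; rewrite ?mulr0.
Qed.

End spikes.

Theorem theorem3p1 (R : realType) (d : linf R) :
  [/\ wopnorm (mulop d) = wopnorm (fshift d),
      wopnorm (fshift d) = wopnorm (bshift d)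
    & wopnorm (bshift d) = linf_norm d].
Proof. by rewrite wopnorm_mulop wopnorm_fshift wopnorm_bshift. Qed.
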